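(* Let $K$ be a number field of degree $t+2s$ with signature $(t,s)$, $s\ge1$, let $\sigma_1,\dots,\sigma_t$ be its real embeddings and $\sigma_{t+1},\dots,\sigma_{t+s}$ a set of complex embeddings, one from each pair of complex conjugate embeddings; write $\alpha^{(i)}=\sigma_i(\alpha)$, and identify $K$ with $\sigma_{t+1}(K)\subset\mathbb{C}$ (so $\alpha=\alpha^{(t+1)}$). Let $\mathfrak{o}$ be an order of $K$ and let $\epsilon\in\mathfrak{o}$ be a complex Pisot number, i.e. $|\epsilon|>1$ and $|\epsilon^{(i)}|<1$ for all $i\in\{1,\dots,t+s\}$, $i\ne t+1$. Let $\Sigma\subset\mathfrak{o}$ be a finite set, and put $C_i=\max\{|c^{(i)}|: c\in\Sigma\}$ for $i\in\{1,\dots,t+s\}$, $i\neq t+1$. Let $P\subset\mathbb{C}$ be a compact set containing a neighborhood of $0$, and let $$\mathcal{B}(\epsilon,\Sigma,P)=\Big\{\alpha\in\mathfrak{o}: \alpha\in P \text{ and } |\alpha^{(i)}|\le \frac{C_i}{1-|\epsilon^{(i)}|}\text{ for all } i\in\{1,\dots,t+s\},\ i\neq t+1\Big\},$$ which is a finite set. Assume that $$\epsilon P\subset\bigcup_{s\in\Sigma}(s+P).$$ Then for each $\alpha\in\mathfrak{o}$ there exist $N,n\in\mathbb{N}$, elements $c_0,\dots,c_n\in\Sigma$ and $\beta\in\mathcal{B}(\epsilon,\Sigma,P)$ such that $$\alpha\epsilon^N=\beta+\sum_{i=0}^n c_i\epsilon^i.$$ *)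

(* Defs.v *)
(* Complex numbers are R[i] for an arbitrary realType R; R[i]^o carries the
   topology of the complex modulus. *)
From HB Require Export structures.
From mathcomp Require Export all_boot all_order all_algebra all_field finmap.
From mathcomp Require Export all_classical all_reals all_analysis.
From mathcomp Require Export complex.
Export Order.TTheory GRing.Theory Num.Theory numFieldNormedType.Exports.

Set Implicit Arguments.
Unset Strict Implicit.
Unset Printing Implicit Defensive.

Local Open Scope classical_set_scope.
Local Open Scope ring_scope.

Definition real_embedding (R : realType) (K : fieldExtType rat)
    (tau : {rmorphism K -> R[i]}) : Prop :=
  forall x, tau x \is Num.real.

(* The first t entries of sigma list each real embedding exactly once; the last
   s entries contain exactly one member of each pair of complex conjugate
   embeddings. *)
Definition signature_embeddings (R : realType) (K : fieldExtType rat)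
    (t s : nat) (sigma : 'I_(t + s) -> {rmorphism K -> R[i]}) : Prop :=
  [/\ forall i : 'I_t, real_embedding (sigma (lshift s i)),
      forall j : 'I_s, ~ real_embedding (sigma (rshift t j)),
      forall tau : {rmorphism K -> R[i]}, real_embedding tau ->
        exists! i : 'I_t, tau =1 sigma (lshift s i)
    & forall tau : {rmorphism K -> R[i]}, ~ real_embedding tau ->
        exists! j : 'I_s, tau =1 sigma (rshift t j) \/
          (forall x, tau x = (sigma (rshift t j) x)^*)].

(* An order is a subring that is a free Z-module on a Q-basis of K. *)
Definition is_order (K : fieldExtType rat) (o : {pred K}) : Prop :=
  subring_closed o /\
  exists b : (\dim {:K}).-tuple K,
    basis_of {:K} b /\ forall x, x \in o <-> inIntSpan b x.

(* With indices starting at 0, the embedding sigma_{t+1} has index t. *)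
Definition idx0 (t s : nat) (s_gt0 : (0 < s)%N) : 'I_(t + s) :=
  rshift t (Ordinal s_gt0).

Definition complex_pisot (R : realType) (K : fieldExtType rat) (n : nat)
    (sigma : 'I_n -> {rmorphism K -> R[i]}) (i0 : 'I_n) (eps : K) : Prop :=
  1 < Normc.normc (sigma i0 eps) /\
  forall i, i != i0 -> Normc.normc (sigma i eps) < 1.

(* The default value 0 only matters for empty Sigma. *)
Definition maxabs (R : realType) (K : fieldExtType rat)
    (tau : {rmorphism K -> R[i]}) (Sigma : {fset K}) : R :=
  \big[Num.max/0]_(c <- Sigma) Normc.normc (tau c).

Definition calB (R : realType) (K : fieldExtType rat) (n : nat)
    (sigma : 'I_n -> {rmorphism K -> R[i]}) (i0 : 'I_n) (o : {pred K})
    (eps : K) (Sigma : {fset K}) (P : set R[i]^o) : set K :=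
  [set a | [/\ a \in o, P (sigma i0 a)
    & forall i, i != i0 ->
        Normc.normc (sigma i a) <=
        maxabs (sigma i) Sigma / (1 - Normc.normc (sigma i eps))]].

(* Main.v *)
Require Import Defs.
From mathcomp Require Import ring.

(** Write [e = sigma_{t+1} eps].  As [|e| > 1] and [P] is a neighbourhood of
    [0], some [alpha / e ^ k] lies in [P]; iterating the covering hypothesis
    [k + N] times from there yields a digit sum [y] of length [k + N] such that
    [alpha * eps ^ N - y] lies in the order and in [P].  At the other embeddings
    the geometric series bounds this remainder by
    [|alpha| |eps| ^ N + C / (1 - |eps|)].  The remainders hence lie in one
    finite set for all [N], and a finite set has a gap above each
    [C / (1 - |eps|)]: for large [N] the vanishing error term can be dropped.

    Finiteness of the elements of an order with bounded conjugates: the [t + 2s]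
    embeddings are pairwise distinct, so by Artin's independence of characters
    the matrix of conjugates of a basis is invertible, and the integer
    coordinates are bounded in terms of the conjugates. *)

Set Implicit Arguments.
Unset Strict Implicit.
Unset Printing Implicit Defensive.

Local Open Scope classical_set_scope.
Local Open Scope ring_scope.

Local Notation normc := (@Normc.normc _).

Section ComplexModulus.
Variable R : rcfType.
Implicit Types x y : R[i].

Lemma normr_normc x : `|x| = (normc x)%:C%C.
Proof. by []. Qed.

Lemma normc_ge0 x : 0 <= normc x.
Proof. exact: (@normr_ge0 R (Rcomplex R)). Qed.

Lemma ler_normcB x y : normc (x - y) <= normc x + normc y.
Proof. exact: (@ler_normB R (Rcomplex R)). Qed.

Lemma ler_normc_sum (I : finType) (F : I -> R[i]) :
  normc (\sum_i F i) <= \sum_i normc (F i).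
Proof. exact: (@ler_norm_sum R (Rcomplex R)). Qed.

Lemma ler_dist_normc x y : `|normc x - normc y| <= normc (x - y).
Proof. exact: (@ler_dist_dist R (Rcomplex R)). Qed.

Lemma normcX x n : normc (x ^+ n) = normc x ^+ n.
Proof. by apply: complexI; rewrite rmorphXn -!normr_normc normrX. Qed.

Lemma normc_conj x : normc (x^*) = normc x.
Proof. exact/complexI/norm_conjC. Qed.

Lemma normc_intr (z : int) : normc z%:~R = `|z%:~R| :> R.
Proof.
apply: complexI; rewrite -normr_normc -!intr_norm.
by rewrite [RHS](rmorph_int (real_complex R)).
Qed.

Lemma normc_continuous : continuous (normc : R[i]^o -> R^o).
Proof.
move=> x; apply/(@cvgrPdist_lt _ _ _ _ (nbhs_filter x)) => e e_gt0.
apply/nbhs_ballP; exists e%:C%C; rewrite /= ?ltcR// => y xy.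
by rewrite -ltcR; apply: le_lt_trans xy; rewrite lecR ler_dist_normc.
Qed.

End ComplexModulus.

Lemma compact_normc_bounded (R : realType) (P : set R[i]^o) :
  compact P -> exists B : R, forall x, P x -> normc x <= B.
Proof.
move=> cP.
have [M [_ MB]] : bounded_set ((normc : R[i]^o -> R^o) @` P).
  apply/compact_bounded/(continuous_compact _ cP).
  exact/continuous_subspaceT/normc_continuous.
exists (M + 1) => x Px; apply: le_trans (ler_norm _) _.
by apply: MB; [rewrite ltrDl | exists x].
Qed.

Lemma cvg_div_expr (R : realType) (x e : R[i]) : 1 < normc e ->
  (x / e ^+ k : R[i]^o) @[k --> \oo] --> (0 : R[i]^o).
Proof.
move=> e_gt1; apply/cvgr0Pnorm_lt => d d_gt0.
have nd_gt0 : 0 < normc d by rewrite -ltcR -normr_normc normr_gt0 gt_eqF.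
have e_gt0 : 0 < normc e := lt_trans ltr01 e_gt1.
have : geometric (normc x) (normc e)^-1 k @[k --> \oo] --> (0 : R).
  by apply: cvg_geometric; rewrite ger0_norm ?invr_ge0 ?ltW ?invf_lt1.
move=> /cvgr_lt/(_ _ nd_gt0); apply: filterS => k /= xk.
rewrite -[ltRHS]gtr0_norm// !normr_normc ltcR.
by rewrite Normc.normcM Normc.normcV normcX -exprVn.
Qed.

Lemma near_finite_set_le (R : realFieldType) (I : Type) (F : set_system I)
    {FF : Filter F} (T : choiceType) (X : set T) (f : T -> R) (u : I -> R)
    (b : R) :
  finite_set X -> u @ F --> b ->
  \forall n \near F, forall x, X x -> f x <= u n -> f x <= b.
Proof.
move=> /finite_fsetP[D ->] ub.
suff : \forall n \near F,
    (\bigcap_(x in [set` D]) [set n | f x <= u n -> f x <= b]) n by [].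
apply: filter_bigI => x _; have [fb|bf] := leP (f x) b; first by near=> n.
have /cvgr_lt/(_ _ bf) := ub.
by apply: filterS => n un /le_lt_trans/(_ un); rewrite ltxx.
Unshelve. all: by end_near. Qed.

(* Artin's argument: subtracting [tau ord0 y] times the relation at [x] from the
   relation at [x * y] removes [tau ord0] from it. *)
Lemma monoid_morphism_independent (A : pzSemiRingType) (L : idomainType)
    (m : nat) (tau : 'I_m -> A -> L) :
  (forall i, GRing.monoid_morphism (tau i)) ->
  (forall i j, tau i =1 tau j -> i = j) ->
  forall a : 'I_m -> L, (forall x, \sum_i a i * tau i x = 0) ->
  forall i, a i = 0.
Proof.
elim: m tau => [|m IHm] tau tauM tau_inj a a0; first by case.
have a_lift0 (i : 'I_m) : a (lift ord0 i) = 0.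
  have a_diff0 y : a (lift ord0 i) * (tau (lift ord0 i) y - tau ord0 y) = 0.
    apply: (IHm (fun i => tau (lift ord0 i)) _ _
      (fun i => a (lift ord0 i) * (tau (lift ord0 i) y - tau ord0 y))) => //.
      by move=> j k /tau_inj /lift_inj.
    move=> x.
    transitivity (\sum_j a j * (tau j y - tau ord0 y) * tau j x).
      by rewrite [RHS]big_ord_recl subrr mulr0 mul0r add0r.
    transitivity (\sum_j a j * tau j (x * y) -
        (\sum_j a j * tau j x) * tau ord0 y); last by rewrite !a0 mul0r subrr.
    rewrite mulr_suml -sumrB; apply: eq_bigr => j _.
    by rewrite (tauM j).2; ring.
  apply: contrapT => /eqP ai0.
  have /tau_inj// : tau ord0 =1 tau (lift ord0 i).
  move=> y; have /eqP := a_diff0 y.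
  by rewrite mulf_eq0 (negPf ai0) subr_eq0 => /eqP.
move=> i; have [j ->|->] := unliftP ord0 i; first exact: a_lift0.
have := a0 1; rewrite big_ord_recl (tauM ord0).1 mulr1 big1 ?addr0// => j _.
by rewrite a_lift0 mul0r.
Qed.

Section ConjugateMatrix.
Variables (K : fieldExtType rat) (L : fieldType) (n m : nat).
Variables (tau : 'I_n -> {rmorphism K -> L}) (b : m.-tuple K).

Definition conjugate_matrix : 'M[L]_(n, m) := \matrix_(i, k) tau i b`_k.

Hypothesis tau_inj : forall i j, tau i =1 tau j -> i = j.
Hypothesis b_basis : basis_of {:K} b.

Lemma conjugate_matrix_row_free : row_free conjugate_matrix.
Proof.
apply: inj_row_free => v v0; apply/rowP => i; rewrite mxE.
apply: (monoid_morphism_independent _ tau_inj) => [j|x].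
  exact: rmorphism_monoidP.
rewrite (coord_basis b_basis (memvf x)).
under eq_bigr do rewrite rmorph_sum mulr_sumr.
rewrite exchange_big big1// => k _.
have /rowP/(_ k) := v0; rewrite !mxE => vk.
under eq_bigr do rewrite rmorphZ_num mulrCA.
rewrite -mulr_sumr -[RHS](mulr0 (ratr (coord b k x))) -[in RHS]vk.
by congr (_ * _); apply: eq_bigr => j _; rewrite mxE.
Qed.

Lemma exists_coord_conjugates : m = n ->
  exists W : 'M[L]_(m, n),
    forall x k, ratr (coord b k x) = \sum_i W k i * tau i x.
Proof.
move=> mn; have /row_fullP[W WM] : row_full conjugate_matrix.
  by rewrite /row_full (eqP conjugate_matrix_row_free) mn.
exists W => x k.
transitivity ((W *m conjugate_matrix *m (\col_l ratr (coord b l x))) k ord0).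
  by rewrite WM mul1mx mxE.
rewrite -mulmxA mxE; apply: eq_bigr => i _; congr (_ * _).
rewrite mxE [in RHS](coord_basis b_basis (memvf x)) rmorph_sum.
by apply: eq_bigr => l _; rewrite !mxE rmorphZ_num mulrC.
Qed.

End ConjugateMatrix.

Lemma finite_bounded_int_span (V : zmodType) (n D : nat) (b : n.-tuple V) :
  finite_set [set x : V | exists a : int ^ n,
    x = \sum_(i < n) b`_i *~ a i /\ forall i, (`|a i| <= D)%N].
Proof.
pose f (g : {ffun 'I_n -> 'I_D.+1 * bool}) : V :=
  \sum_(i < n) b`_i *~ ((-1) ^+ (g i).2 * (g i).1%:Z).
apply: sub_finite_set (finite_image f (@finite_finset _ setT)).
move=> x [a [-> aD]]; exists [ffun i => (inord `|a i|%N, a i < 0)] => //.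
apply: eq_bigr => i _; rewrite ffunE /= inordK ?ltnS ?aD//.
by rewrite -intEsign.
Qed.

Lemma finite_bounded_conjugates (R : archiRcfType) (K : fieldExtType rat)
    (n : nat) (tau : 'I_n -> {rmorphism K -> R[i]}) (m : nat) (b : m.-tuple K)
    (B : 'I_n -> R) :
  (forall i j, tau i =1 tau j -> i = j) -> basis_of {:K} b -> m = n ->
  finite_set [set x | inIntSpan b x /\ forall i, normc (tau i x) <= B i].
Proof.
move=> tau_inj bP mn; have [W coordE] := exists_coord_conjugates tau_inj bP mn.
pose S k := \sum_i normc (W k i) * `|B i|.
have S_ge0 k : 0 <= S k by apply: sumr_ge0 => i _; rewrite mulr_ge0 ?normc_ge0.
apply: sub_finite_set (finite_bounded_int_span (Num.bound (\sum_k S k)) b).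
move=> x [[a ax] xB]; exists a; split=> // k.
have ak : coord b k x = (a k)%:~R.
  rewrite ax; under eq_bigr do rewrite -scaler_int.
  exact: coord_sum_free (basis_free bP).
rewrite -(ler_nat R) natr_absz intr_norm -normc_intr -ratr_int -ak coordE.
apply: le_trans (ltW (archi_boundP (sumr_ge0 _ (fun k _ => S_ge0 k)))).
apply: (@le_trans _ _ (S k)); last by rewrite (bigD1 k)//= lerDl sumr_ge0.
apply: le_trans (ler_normc_sum _) _; apply: ler_sum => i _.
by rewrite Normc.normcM ler_wpM2l ?normc_ge0// (le_trans (xB i)) ?ler_norm.
Qed.

Section SignatureEmbeddings.
Variables (R : realType) (K : fieldExtType rat) (t s : nat).
Variable sigma : 'I_(t + s) -> {rmorphism K -> R[i]}.

Definition full_embeddings (k : 'I_(t + s + s)) : {rmorphism K -> R[i]} :=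
  match fintype.split k with
  | inl i => sigma i
  | inr j => (@Num.conj R[i] \o sigma (rshift t j) : {rmorphism K -> R[i]})
  end.

Hypothesis sigmaP : signature_embeddings sigma.

Lemma signature_embeddings_inj i j : sigma i =1 sigma j -> i = j.
Proof.
case: sigmaP => real_s nonreal_s uniq_real uniq_nonreal.
case: (split_ordP i) => i' ->; case: (split_ordP j) => j' -> eq_ij.
- have [k [_ k_uniq]] := uniq_real _ (real_s i').
  by rewrite -(k_uniq j' eq_ij) -(k_uniq i' (fun=> erefl)).
- by case: (nonreal_s j') => x; rewrite -eq_ij; apply: real_s.
- by case: (nonreal_s i') => x; rewrite eq_ij; apply: real_s.
- have [k [_ k_uniq]] := uniq_nonreal _ (nonreal_s i').
  rewrite -(k_uniq j' (or_introl eq_ij)).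
  by rewrite -(k_uniq i' (or_introl (fun=> erefl))).
Qed.

Lemma signature_embeddings_neq_conj i (j : 'I_s) :
  ~ (forall x, sigma i x = (sigma (rshift t j) x)^*).
Proof.
case: sigmaP => real_s nonreal_s uniq_real uniq_nonreal.
case: (split_ordP i) => i' -> eq_ij.
  by case: (nonreal_s j) => x; rewrite -CrealJ -eq_ij; apply: real_s.
have [k [_ k_uniq]] := uniq_nonreal _ (nonreal_s i').
have ij : i' = j.
  rewrite -(k_uniq j (or_intror eq_ij)).
  by rewrite -(k_uniq i' (or_introl (fun=> erefl))).
by case: (nonreal_s j) => x; apply/CrealP; rewrite -eq_ij ij.
Qed.

Lemma full_embeddings_inj k l : full_embeddings k =1 full_embeddings l -> k = l.
Proof.
rewrite /full_embeddings; case: (split_ordP k) => i ->;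
  case: (split_ordP l) => j -> eq_ij.
- by rewrite (signature_embeddings_inj eq_ij).
- by case: (signature_embeddings_neq_conj eq_ij).
- by case: (@signature_embeddings_neq_conj j i) => x; rewrite -eq_ij.
- congr (rshift _ _); apply: (@rshift_inj t).
  apply: signature_embeddings_inj => x; exact: (can_inj conjCK (eq_ij x)).
Qed.

Lemma finite_order_bounded_conjugates (o : {pred K}) (B : 'I_(t + s) -> R) :
  \dim {:K} = (t + 2 * s)%N -> is_order o ->
  finite_set [set x | x \in o /\ forall i, normc (sigma i x) <= B i].
Proof.
move=> degK [_ [b [bP ob]]].
have dE : \dim {:K} = (t + s + s)%N by rewrite degK mul2n -addnn addnA.
pose full_B (k : 'I_(t + s + s)) : R :=
  match fintype.split k with inl i => B i | inr j => B (rshift t j) end.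
apply: sub_finite_set
  (finite_bounded_conjugates full_B full_embeddings_inj bP dE).
move=> x [/ob xb xB]; split=> // k.
by rewrite /full_embeddings /full_B; case: fintype.split => i;
  rewrite /= ?normc_conj.
Qed.

End SignatureEmbeddings.

(* Horner form of the sums [\sum_(i < n) c i * x ^+ i] with digits in [D]. *)
Fixpoint digit_sums (A : pzSemiRingType) (D : set A) (x : A) (n : nat) :
    set A :=
  if n is m.+1 then [set d + x * y | d in D & y in digit_sums D x m]
  else [set 0].

Lemma digit_sumsP (A : comPzSemiRingType) (D : set A) (x : A) (n : nat)
    (y : A) :
  digit_sums D x n y ->
  exists2 c : 'I_n -> A, forall i, D (c i) & y = \sum_(i < n) c i * x ^+ i.
Proof.
elim: n y => [|n IHn] y /=.
  by move=> ->; exists (fun=> 0); [case | rewrite big_ord0].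
move=> [d Dd [_ /IHn[c Dc ->] <-]].
exists (fun i => oapp c d (unlift ord0 i)) => [i|].
  by case: unliftP => /=.
rewrite big_ord_recl unlift_none expr0 mulr1 mulr_sumr; congr (_ + _).
by apply: eq_bigr => i _; rewrite liftK exprS mulrCA.
Qed.

Lemma semiring_closed_digit_sums (A : pzSemiRingType) (o : {pred A})
    (D : set A) (x : A) (n : nat) :
  GRing.semiring_closed o -> D `<=` [set` o] -> x \in o ->
  digit_sums D x n `<=` [set` o].
Proof.
move=> [[zero_o oD] [_ oM]] Do xo; elim: n => [_ -> //|n IHn] /=.
by move=> _ [d /Do od [y /IHn oy <-]]; rewrite /= oD ?oM.
Qed.

Lemma mulr_closedX (A : pzSemiRingType) (o : {pred A}) (x : A) (n : nat) :
  GRing.mulr_closed o -> x \in o -> x ^+ n \in o.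
Proof. by move=> [one_o oM] xo; elim: n => // n IHn; rewrite exprS oM. Qed.

Lemma ler_normc_digit_sums (R : rcfType) (A : pzSemiRingType)
    (tau : {rmorphism A -> R[i]}) (D : set A) (x : A) (C : R) (n : nat)
    (y : A) :
  normc (tau x) < 1 -> 0 <= C -> (forall d, D d -> normc (tau d) <= C) ->
  digit_sums D x n y -> normc (tau y) <= C / (1 - normc (tau x)).
Proof.
move=> x_lt1 C_ge0 DC; have x1_gt0 : 0 < 1 - normc (tau x) by rewrite subr_gt0.
elim: n y => [_ ->|n IHn _ [d Dd [y /IHn yC <-]]].
  by rewrite rmorph0 Normc.normc0 divr_ge0// ltW.
have -> : C / (1 - normc (tau x)) =
    C + normc (tau x) * (C / (1 - normc (tau x))).
  by field; rewrite gt_eqF.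
rewrite rmorphD rmorphM (le_trans (le_normcD _ _))// lerD ?DC//.
by rewrite Normc.normcM ler_wpM2l ?normc_ge0.
Qed.

Lemma cover_digit_sums (A L : pzRingType) (tau : {rmorphism A -> L})
    (D : set A) (x : A) (P : set L) :
  [set tau x * p | p in P] `<=` \bigcup_(d in D) [set tau d + p | p in P] ->
  forall n z, P z -> exists2 y, digit_sums D x n y & P (tau x ^+ n * z - tau y).
Proof.
move=> cover; elim=> [|n IHn] z Pz.
  by exists 0; rewrite ?rmorph0 ?mul1r ?subr0.
have [y Dy Py] := IHn z Pz; have [d Dd [p Pp dpE]] := cover _ (imageP _ Py).
exists (d + x * y); first by exists d => //; exists y.
by rewrite rmorphD rmorphM opprD addrCA exprS -mulrA -mulrBr -dpE addKr.
Qed.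

Lemma exists_digit_sum_remainder (R : realType) (A : pzRingType)
    (tau : {rmorphism A -> R[i]}) (D : set A) (x : A) (P : set R[i]^o) :
  nbhs (0 : R[i]^o) P -> 1 < normc (tau x) ->
  [set tau x * p | p in P] `<=` \bigcup_(d in D) [set tau d + p | p in P] ->
  forall a, exists k, forall N,
    exists2 y, digit_sums D x (k + N).+1 y & P (tau (a * x ^+ N - y)).
Proof.
move=> P_nbhs0 x_gt1 cover a.
have [k _ /(_ k.+1 (leqnSn k))/= Pk] := cvg_div_expr (tau a) x_gt1 P_nbhs0.
have x_neq0 : tau x != 0.
  by apply: contraTneq x_gt1 => ->; rewrite Normc.normc0 -leNgt ler01.
exists k => N; have [y Dy Py] := cover_digit_sums cover (k + N).+1 Pk.
exists y => //; rewrite rmorphB.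
suff <- : tau x ^+ (k + N).+1 * (tau a / tau x ^+ k.+1) =
    tau (a * x ^+ N) by [].
rewrite rmorphM rmorphXn -addSn exprD.
by field; rewrite expf_neq0.
Qed.

Section MaxAbs.
Variables (R : realType) (K : fieldExtType rat).
Variables (tau : {rmorphism K -> R[i]}) (Sigma : {fset K}).

Lemma maxabs_ge0 : 0 <= maxabs tau Sigma.
Proof.
rewrite /maxabs; elim/big_ind: _ => // [x y x_ge0 _|c _].
  by rewrite le_max x_ge0.
exact: normc_ge0.
Qed.

Lemma ler_normc_maxabs c : c \in Sigma -> normc (tau c) <= maxabs tau Sigma.
Proof. by move=> cS; rewrite /maxabs; apply: (le_bigmax_seq _ c). Qed.

End MaxAbs.

Section ConjugateBox.
Variables (R : realType) (K : fieldExtType rat) (n : nat).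
Variables (sigma : 'I_n -> {rmorphism K -> R[i]}) (i0 : 'I_n) (o : {pred K}).
Variable P : set R[i]^o.

Definition conjugate_box (C : 'I_n -> R) : set K :=
  [set a | [/\ a \in o, P (sigma i0 a)
    & forall i, i != i0 -> normc (sigma i a) <= C i]].

Lemma near_conjugate_box_subset (u : 'I_n -> R ^nat) (b : 'I_n -> R) :
  finite_set (conjugate_box (fun i => b i + 1)) ->
  (forall i, i != i0 -> u i @ \oo --> b i) ->
  \forall N \near \oo, conjugate_box (u ^~ N) `<=` conjugate_box b.
Proof.
move=> box_finite ub.
have u_le : \forall N \near \oo, forall i, i != i0 -> u i N <= b i + 1.
  apply: filter_forall => i; have [->|ii0] := eqVneq i i0; first by near=> N.
  have /cvgr_le/(_ (b i + 1)) := ub i ii0.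
  by rewrite ltrDl => /(_ ltr01); apply: filterS.
have gap : \forall N \near \oo, forall i, i != i0 -> forall x,
    conjugate_box (fun j => b j + 1) x ->
    normc (sigma i x) <= u i N -> normc (sigma i x) <= b i.
  apply: filter_forall => i; have [->|ii0] := eqVneq i i0; first by near=> N.
  apply: filterS _
    (near_finite_set_le (normc \o sigma i) box_finite (ub i ii0)).
  by move=> N uN_le _ x; apply: uN_le.
near=> N => x [xo xP xu]; split=> // i ii0.
apply: (near gap N) => //; last exact: xu.
split=> // j ji0; apply: le_trans (xu j ji0) _.
exact: (near u_le N).
Unshelve. all: by end_near. Qed.

Lemma sub_digit_sum_conjugate_box (eps : K) (Sigma : {fset K}) (alpha y : K)
    (N m : nat) :
  GRing.subring_closed o -> eps \in o -> {subset Sigma <= o} -> alpha \in o ->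
  (forall i, i != i0 -> normc (sigma i eps) < 1) ->
  digit_sums [set` Sigma] eps m y -> P (sigma i0 (alpha * eps ^+ N - y)) ->
  conjugate_box (fun i => normc (sigma i alpha) * normc (sigma i eps) ^+ N +
      maxabs (sigma i) Sigma / (1 - normc (sigma i eps)))
    (alpha * eps ^+ N - y).
Proof.
move=> oS eps_o Sigma_o alpha_o eps_lt1 Dy Py; split=> // [|i ii0].
  have [_ oB oM] := oS; rewrite oB ?oM ?(mulr_closedX _ oS)//.
  exact: (semiring_closed_digit_sums oS Sigma_o eps_o Dy).
rewrite rmorphB (le_trans (ler_normcB _ _))//.
rewrite rmorphM rmorphXn Normc.normcM normcX lerD2l.
apply: ler_normc_digit_sums Dy; first exact: eps_lt1.
  exact: maxabs_ge0.
exact: ler_normc_maxabs.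
Qed.

End ConjugateBox.

Lemma finite_conjugate_box (R : realType) (K : fieldExtType rat) (t s : nat)
    (sigma : 'I_(t + s) -> {rmorphism K -> R[i]}) (i0 : 'I_(t + s))
    (o : {pred K}) (P : set R[i]^o) (C : 'I_(t + s) -> R) :
  \dim {:K} = (t + 2 * s)%N -> signature_embeddings sigma -> is_order o ->
  compact P -> finite_set (conjugate_box sigma i0 o P C).
Proof.
move=> degK sigmaP oP /compact_normc_bounded[B PB].
pose C' i := if i == i0 then B else C i.
apply: sub_finite_set (finite_order_bounded_conjugates sigmaP C' degK oP).
move=> a [ao aP aC]; split=> // i; rewrite /C'.
by case: eqVneq => [->|/aC//]; apply: PB.
Qed.

Theorem theorem3p1 (R : realType) (K : fieldExtType rat) (t s : nat)
    (s_gt0 : (0 < s)%N)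
    (degK : \dim {:K} = (t + 2 * s)%N)
    (sigma : 'I_(t + s) -> {rmorphism K -> R[i]})
    (sigmaP : signature_embeddings sigma)
    (o : {pred K}) (oP : is_order o)
    (eps : K) (eps_o : eps \in o)
    (eps_pisot : complex_pisot sigma (idx0 t s_gt0) eps)
    (Sigma : {fset K}) (Sigma_o : {subset Sigma <= o})
    (P : set R[i]^o) (P_compact : compact P) (P_nbhs0 : nbhs (0 : R[i]^o) P)
    (P_cover : [set sigma (idx0 t s_gt0) eps * p | p in P] `<=`
       \bigcup_(c in [set` Sigma])
         [set sigma (idx0 t s_gt0) c + p | p in P]) :
  finite_set (calB sigma (idx0 t s_gt0) o eps Sigma P) /\
  forall alpha : K, alpha \in o ->
    exists (N n : nat) (c : 'I_n.+1 -> K) (beta : K),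
      [/\ forall i, c i \in Sigma,
          calB sigma (idx0 t s_gt0) o eps Sigma P beta
        & alpha * eps ^+ N = beta + \sum_(i < n.+1) c i * eps ^+ i].
Proof.
set i0 := idx0 t s_gt0 in eps_pisot P_cover *; clearbody i0.
case: eps_pisot => eps_gt1 eps_lt1.
pose b i := maxabs (sigma i) Sigma / (1 - normc (sigma i eps)).
have box_finite C : finite_set (conjugate_box sigma i0 o P C).
  exact: finite_conjugate_box.
split; first exact: (box_finite b).
move=> alpha alpha_o.
pose u i N := normc (sigma i alpha) * normc (sigma i eps) ^+ N + b i.
have ub i : i != i0 -> u i @ \oo --> b i.
  move=> ii0; rewrite -[b i]add0r; apply: cvgD; last exact: cvg_cst.
  by apply: cvg_geometric; rewrite ger0_norm ?normc_ge0 ?eps_lt1.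
have [N _ /(_ N (leqnn N)) box_le] :=
  near_conjugate_box_subset (box_finite _) ub.
have [k /(_ N)[y Dy Py]] :=
  exists_digit_sum_remainder P_nbhs0 eps_gt1 P_cover alpha.
have [c cS yE] := digit_sumsP Dy.
exists N, (k + N)%N, c, (alpha * eps ^+ N - y); split=> //.
  have [oS _] := oP; apply: box_le.
  exact: (sub_digit_sum_conjugate_box oS eps_o Sigma_o alpha_o eps_lt1 Dy Py).
by rewrite -yE subrK.
Qed.
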